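(* Let $G$ be a $0$-dimensional compact group. Then there exist an ordinal $\kappa$ and a continuous inverse sequence $\mathbb{S}=\langle G_\alpha;p_\alpha^\beta;\kappa\rangle$ in the category of topological groups with $G=\varprojlim\mathbb{S}$ such that $G_0$ is the trivial group and each $p_\alpha^{\alpha+1}\colon G_{\alpha+1}\to G_\alpha$ ($\alpha<\kappa$) is an epimorphism with a finite kernel. Furthermore, if $G$ is infinite then $\kappa=\operatorname{w}(G)$.
   Context: Compact groups are compact Hausdorff topological groups; an epimorphism is a continuous surjective homomorphism. $\operatorname{w}(G)$ denotes the topological weight of $G$ (least cardinality of a base). A continuous inverse sequence $\langle G_\alpha; p_\alpha^\beta;\kappa\rangle$ with limit $G$ consists of compact groups $G_\alpha$ ($\alpha\leqslant\kappa$), with $G_\kappa=G$, and continuous homomorphisms $p_\alpha^\beta\colon G_\beta\to G_\alpha$ ($\alpha\leqslant\beta\leqslant\kappa$) with $p_\alpha^\alpha=\mathrm{id}$ and $p_\alpha^\beta\circ p_\beta^\gamma=p_\alpha^\gamma$ for $\alpha\leqslant\beta\leqslant\gamma$, such that for every limit ordinal $\delta\leqslant\kappa$ the group $G_\delta$ together with the maps $p_\alpha^\delta$ ($\alpha<\delta$) is the inverse limit of $\langle G_\alpha;p_\alpha^\beta\rangle_{\alpha\leqslant\beta<\delta}$. *)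

(* Defs.v *)
From HB Require Import structures.
From mathcomp Require Import all_boot all_order.
From mathcomp Require Import all_classical topology.
From mathcomp Require wochoice.

Set Implicit Arguments.
Unset Strict Implicit.
Unset Printing Implicit Defensive.

Local Open Scope classical_set_scope.
Local Open Scope group_scope.
Local Open Scope order_scope.

(* The library only has commutative topological groups, written additively. *)
HB.mixin Record Topological_isTopologicalGroup G
    of Topological G & Group G := {
  mulg_continuous : continuous (fun xy : G * G => xy.1 * xy.2) ;
  invg_continuous : continuous (fun x : G => x^-1)
}.

#[short(type="topologicalGroupType")]
HB.structure Definition TopologicalGroup :=
  {G of Topological G & Group G & Topological_isTopologicalGroup G}.

Definition compact_group (G : topologicalGroupType) : Prop :=
  compact [set: G] /\ hausdorff_space G.

(* This is the usual dimension-zero condition.  The library's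
   [zero_dimensional] only asks that points be separated by clopen sets, which
   is weaker for spaces that are not compact. *)
Definition clopen_basis (T : topologicalType) : Prop :=
  basis [set U : set T | clopen U].

Definition topgroup_hom (G H : topologicalGroupType) (f : G -> H) : Prop :=
  continuous f /\ {morph f : x y / x * y}.

Definition epimorphism (G H : topologicalGroupType) (f : G -> H) : Prop :=
  topgroup_hom f /\ range f = [set: H].

Definition kernel (G H : topologicalGroupType) (f : G -> H) : set G :=
  [set x | f x = 1].

(* An ordinal is represented by a well-ordered type of that order type; its
   elements are the ordinals below it. *)
Record ordinalNumber := OrdinalNumber {
  onum_disp : Order.disp_t ;
  onum_sort :> orderType onum_disp ;
  onum_wo : wochoice.well_order (<=%O : rel onum_sort)
}.

(* The ordinals alpha <= kappa: [Some a] for those below [kappa], and [None]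
   for [kappa] itself. *)
Definition upto (kappa : ordinalNumber) : Type := option kappa.

Section Upto.
Variable kappa : ordinalNumber.
Implicit Types a b c : upto kappa.

Definition upto_le a b : bool :=
  match a, b with
  | _, None => true
  | None, Some _ => false
  | Some x, Some y => x <= y
  end.

Definition upto_lt a b : bool := upto_le a b && ~~ upto_le b a.

Definition is_zero a : Prop := forall b, upto_le a b.

Definition is_succ a b : Prop :=
  upto_lt a b /\ forall c, upto_lt a c -> upto_le b c.

Definition is_limit a : Prop := ~ is_zero a /\ forall b, ~ is_succ b a.

End Upto.

(* The ordinal [kappa] is the weight of [T]: it is an initial ordinal whose
   cardinality is the least cardinality of a base. *)
Definition is_weight (T : topologicalType) (kappa : ordinalNumber) : Prop :=
  [/\ forall a : kappa, ~ ([set: kappa] #<= [set b : kappa | b < a])%card,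
      exists2 B : set (set T), basis B & ([set: kappa] #= B)%card
    & forall B : set (set T), basis B -> ([set: kappa] #<= B)%card].

Section InverseSequence.
Variable kappa : ordinalNumber.

(* [L], with the maps [p a d] for [a < d], is the limit in the category of
   topological groups of the part of the system below [d]. *)
Definition is_inverse_limit (G_ : upto kappa -> topologicalGroupType)
    (p : forall a b, G_ b -> G_ a) (d : upto kappa) : Prop :=
  forall (H : topologicalGroupType) (f : forall a, H -> G_ a),
    (forall a, upto_lt a d -> topgroup_hom (f a)) ->
    (forall a b, upto_le a b -> upto_lt b d -> p a b \o f b =1 f a) ->
    exists! g : H -> G_ d,
      topgroup_hom g /\ forall a, upto_lt a d -> p a d \o g =1 f a.

(* The groups of index below [kappa] are given by [G_]; the one of index
   [kappa] is [G]. *)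
Definition stage (G : topologicalGroupType) (G_ : kappa -> topologicalGroupType)
    (a : upto kappa) : topologicalGroupType :=
  if a is Some x then G_ x else G.

(* [bond a b] is meaningful only for [a <= b]; its other values are not
   constrained. *)
Record continuousInverseSequence (G : topologicalGroupType) := {
  proper_stage : kappa -> topologicalGroupType ;
  obj := stage G proper_stage ;
  bond : forall a b : upto kappa, obj b -> obj a ;
  obj_compact : forall a, compact_group (obj a) ;
  bond_hom : forall a b, upto_le a b -> topgroup_hom (@bond a b) ;
  bond_id : forall a, @bond a a =1 id ;
  bond_comp : forall a b c, upto_le a b -> upto_le b c ->
    @bond a b \o @bond b c =1 @bond a c ;
  bond_limit : forall d, is_limit d -> is_inverse_limit bond d
}.

End InverseSequence.

Arguments bond {kappa G} S a b _ : rename.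

(* Main.v *)
Require Import Defs.
From HB Require Import structures.
From mathcomp Require Import all_boot all_order.
From mathcomp Require Import all_classical topology.
From mathcomp Require Import generic_quotient.
From mathcomp Require wochoice.

(** The group G is cut down one open normal subgroup at a time.  Take for kappa
    the initial ordinal of the least cardinality of a base of G
    ([least_cardinal]), and list such a base as [U b] for [b < kappa].
    Because G is compact and zero-dimensional, every neighbourhood of 1 contains
    an open normal subgroup ([open_normal_subgroup_nbhs]); choose one, [N b],
    inside each [U b] that contains 1.  Since G is Hausdorff, the [N b] intersect
    in the trivial group.

    Put [level a] for the intersection of the [N b] with [b < a], and let the
    stage of index [a] be [G / level a], with the evident maps between quotients.
    At 0 the level is G, so the quotient is trivial; at kappa it is trivial, so
    the quotient is G.  Passing from [a] to its successor replaces [level a] by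
    [level a `&` N a], so the kernel of the bond is
    [level a / (level a `&` N a)], which embeds in the finite group [G / N a]
    ([quotient_bond_succ]).  At a limit [d] the level is the intersection of the
    earlier ones, and compactness turns this into the universal property
    ([quotient_bond_limit]): a compatible family of points is a decreasing chain
    of nonempty closed cosets, so it comes from a point of G, unique modulo
    [level d], and the map obtained in this way is continuous because a closed
    set of [G / level d] that misses a point misses it already at some earlier
    stage.

    The construction makes no distinction between finite and infinite G: for
    every G the ordinal kappa is the weight. *)

Set Implicit Arguments.
Unset Strict Implicit.
Unset Printing Implicit Defensive.

Import Order.TTheory.

Local Open Scope classical_set_scope.
Local Open Scope group_scope.

(** * Ordinals and least cardinalities *)

Section OrdinalOfWellOrder.
Context (T : choiceType) (R : rel T) (woR : wochoice.well_order R).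

(** A copy of [T], so that the order built from [R] cannot clash with an order
    that [T] may already carry. *)
Definition well_ordered : Type := T.
HB.instance Definition _ := Choice.on well_ordered.

Let R_chain : wochoice.wo_chain R predT.
Proof. by move=> A _; exact: woR. Qed.

Let R_total : total R.
Proof. by move=> x y; exact: wochoice.wo_chainW R_chain _ _ isT isT. Qed.

Let R_refl : reflexive R. Proof. by move=> x; have := R_total x x; case: (R x x). Qed.

Let R_anti : antisymmetric R.
Proof. by move=> x y; exact: wochoice.wo_chain_antisymmetric R_chain _ _ isT isT. Qed.

Let R_trans : transitive R.
Proof.
move=> y x z Rxy Ryz.
have [|m [[xyz mlow] _]] := woR (A := [pred t | t \in [:: x; y; z]]).
  by exists x; rewrite !inE eqxx.
have lowx : R m x by apply: mlow; rewrite !inE eqxx.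
have lowy : R m y by apply: mlow; rewrite !inE eqxx orbT.
have lowz : R m z by apply: mlow; rewrite !inE eqxx !orbT.
move: xyz; rewrite !inE => /or3P[] /eqP mE; subst m => //.
  by rewrite (@R_anti x y) // Rxy.
by rewrite (@R_anti z y) // lowy.
Qed.

HB.instance Definition _ :=
  Order.Le_isPOrder.Build Order.default_display well_ordered R_refl R_anti R_trans.
HB.instance Definition _ :=
  Order.POrder_isTotal.Build Order.default_display well_ordered R_total.

Definition ordinal_of_well_order : ordinalNumber :=
  @OrdinalNumber Order.default_display well_ordered woR.

End OrdinalOfWellOrder.

Section Ordinals.
Variable kappa : ordinalNumber.

Lemma ordinal_least (A : set kappa) :
  A !=set0 -> exists2 z, A z & forall x, A x -> (z <= x)%O.
Proof.
move=> [x Ax]; have [|z [[zA zlow] _]] := onum_wo (A := [pred t | `[< A t >]]).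
  by exists x; apply/asboolP.
by exists z => [|y Ay]; [apply/asboolP|apply/zlow/asboolP].
Qed.

Lemma ordinal_lt_wf : well_founded (fun x y : kappa => (x < y)%O).
Proof.
move=> x; apply: contrapT => nx.
have [|z nz zlow] := @ordinal_least [set y | ~ Acc (fun x y : kappa => (x < y)%O) y].
  by exists x.
apply: nz; constructor => y yz; apply: contrapT => /zlow.
by rewrite leNgt yz.
Qed.

End Ordinals.

(** The Mostowski collapse of [A], by well-founded recursion: each [x] is sent to
    the least ordinal not yet taken by a smaller element of [A].  Such an ordinal
    exists because the recursion never overtakes [x], so that [x] itself is free. *)
Lemma collapse_exists (kappa : ordinalNumber) (A : set kappa) :
  exists f : kappa -> kappa, forall x,
    (forall y, A y -> (y < x)%O -> f y <> f x) /\
    (forall z, (z < f x)%O -> exists2 y, A y /\ (y < x)%O & f y = z).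
Proof.
pose free (x : kappa) (f : forall y : kappa, (y < x)%O -> kappa) :=
  [set z | forall y (yx : (y < x)%O), A y -> f y yx <> z].
pose step x f := xget x [set z | free x f z /\ forall w, free x f w -> (z <= w)%O].
pose f := Fix (@ordinal_lt_wf kappa) (fun=> kappa) step.
have fE x : f x = step x (fun y _ => f y).
  apply: (Fix_eq _ _ step) => y g h gh; congr (step y _).
  by apply: functional_extensionality_dep => z; apply: funext => zy; exact: gh.
suff fP x : free x (fun y _ => f y) (f x) /\
    forall w, free x (fun y _ => f y) w -> (f x <= w)%O.
  exists f => x; have [fx flow] := fP x; split=> [y Ay yx|z zf]; first exact: fx.
  apply: contrapT => nz; move: zf; rewrite ltNge flow // => y yx Ay fyz.
  by apply: nz; exists y.
elim/(well_founded_ind (@ordinal_lt_wf kappa)): x => x IH.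
suff /(@ordinal_least kappa) [z fz zlow] : free x (fun y _ => f y) !=set0.
  have -> : f x = xget x [set z | free x (fun y _ => f y) z /\
    forall w, free x (fun y _ => f y) w -> (z <= w)%O] by rewrite fE.
  by case: xgetP => [t -> //|/(_ z)]; case.
(* f y <= y for y < x: otherwise y would be free for y, hence equal to an
   earlier value f z <= z < y. *)
have f_le (y : kappa) : (y < x)%O -> (f y <= y)%O.
  elim/(well_founded_ind (@ordinal_lt_wf kappa)): y => y IHy yx.
  apply: (IH y yx).2 => z zy Az fzy.
  have := IHy z zy (lt_trans zy yx).
  by rewrite fzy leNgt zy.
exists x => y yx Ay fyx.
by have := f_le _ yx; rewrite fyx leNgt yx.
Qed.

(** Comparability of cardinals in the sharp form needed for minimality: a set of
    ordinals into which [S] does not embed is already small enough to fit below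
    a member of [S].  The collapse of [A] is an initial segment; either it covers
    [S], or it stays below a member of [S] that it misses. *)
Lemma card_subset_ordinal (kappa : ordinalNumber) (S A : set kappa) :
  (S #<= A)%card \/ exists2 c, S c & (A #<= [set b : kappa | (b < c)%O])%card.
Proof.
have [f fP] := collapse_exists A.
have f_inj : {in A &, injective f}.
  move=> x y /set_mem Ax /set_mem Ay fxy; case: (ltgtP x y) => // ltxy.
    by have [/(_ _ Ax ltxy)] := fP y.
  by have [/(_ _ Ay ltxy)] := fP x; rewrite fxy.
have f_down (x z : kappa) : A x -> (z <= f x)%O -> (f @` A) z.
  move=> Ax; rewrite le_eqVlt => /orP[/eqP->|/(fP x).2[y [Ay _] <-]].
    by exists x.
  by exists y.
have [[c Sc nc]|fA] := pselect (exists2 c, S c & ~ (f @` A) c); [right|left].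
  exists c => //.
  have [g] : $| {injfun A >-> [set b : kappa | (b < c)%O]} |.
    apply/injfunPex; exists f => // x Ax /=.
    by rewrite ltNge; apply/negP => /(f_down _ _ Ax).
  exact: (inj_card_le g).
have SfA : S `<=` f @` A.
  by move=> c Sc; apply: contrapT => nc; apply: fA; exists c.
exact: card_le_trans (subset_card_le SfA) (card_image_le f A).
Qed.

(** The cardinals of the members of a family are well-ordered: fix a well-order on
    the ambient type and take the shortest initial segment that some member of
    the family embeds in.  Shortness makes the ordinal initial, and
    [card_subset_ordinal] makes it a lower bound. *)
Lemma least_cardinal (X : choiceType) (F : set (set X)) : F !=set0 ->
  exists kappa : ordinalNumber,
    [/\ forall a : kappa, ~ ([set: kappa] #<= [set b : kappa | (b < a)%O])%card,
        exists2 B, F B & ([set: kappa] #= B)%card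
      & forall B, F B -> ([set: kappa] #<= B)%card].
Proof.
move=> [B0 FB0]; have [R woR] := wochoice.well_ordering_principle X.
pose mu := ordinal_of_well_order woR.
pose fits (S : set mu) := exists2 B, F B & (B #<= S)%card.
(* [S] is either the initial segment below the least suitable point, or, when no
   proper initial segment is suitable, the whole type. *)
have [S [[B1 FB1 B1S] leastS]] : exists S : set mu, fits S /\
    forall x, S x -> ~ fits [set y | (y < x)%O].
  have [fit_x|nfit] := pselect (exists x : mu, fits [set y | (y < x)%O]).
    have [z fitz zlow] := ordinal_least fit_x.
    exists [set y | (y < z)%O]; split=> // x /= xz fitx.
    by have := zlow x fitx; rewrite leNgt xz.
  exists setT; split=> [|x _ fitx]; last by apply: nfit; exists x.
  by exists B0 => //; exact: subset_card_le.
pose R' : rel S := fun x y => R (val x) (val y).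
have woR' : wochoice.well_order R'.
  move=> P [x Px].
  have [|z [[zP zlow] zuniq]] :=
      woR [pred t | `[< exists2 y : S, y \in P & val y = t >]].
    by exists (val x); apply/asboolP; exists x.
  have /asboolP[y Py yz] := zP.
  exists y; split; first split=> //.
    by move=> t Pt; rewrite /R' yz; apply: zlow; apply/asboolP; exists t.
  move=> t [Pt tlow]; apply: val_inj; rewrite yz; apply: zuniq; split.
    by apply/asboolP; exists t.
  by move=> _ /asboolP[s Ps <-]; exact: tlow.
pose kappa := ordinal_of_well_order woR'.
have kappaS : ([set: kappa] #= S)%card := card_setT S.
have kappa_lt (a b : kappa) :
    (a < b)%O = ((val (a : S) : mu) < (val (b : S) : mu))%O.
  by rewrite !ltNge.
have kappa_le B : F B -> ([set: kappa] #<= B)%card.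
  move=> FB; rewrite (card_le_eql kappaS).
  have [//|[c Sc Bc]] := card_subset_ordinal S (B : set mu).
  by case: (leastS c Sc); exists B.
exists kappa; split=> // [a kappa_a|].
  apply: (leastS (val (a : S))); first exact: set_valP.
  exists B1 => //; apply: (card_le_trans B1S); rewrite -(card_le_eql kappaS).
  apply: (card_le_trans kappa_a).
  have [g] : $| {injfun [set b : kappa | (b < a)%O] >->
                        [set y : mu | (y < (val (a : S) : mu))%O]} |.
    apply/injfunPex; exists (fun b : kappa => val (b : S) : mu) => [b /=|].
      by rewrite kappa_lt.
    by move=> b b' _ _; exact: val_inj.
  exact: (inj_card_le g).
exists B1 => //; rewrite card_eq_le kappa_le//= .
by rewrite (card_le_eqr kappaS).
Qed.

(** * Topological groups and their quotients *)

Record normal_subgroup (G : topologicalGroupType) (N : set G) : Prop := {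
  subgroup1 : N 1 ;
  subgroupM : forall x y, N x -> N y -> N (x * y) ;
  subgroupV : forall x, N x -> N x^-1 ;
  subgroupJ : forall x y, N x -> N (y^-1 * x * y) ;
}.

Lemma cvgMg (G : topologicalGroupType) (T : Type) (F : set_system T)
    (FF : Filter F) (f g : T -> G) (a b : G) :
  f @ F --> a -> g @ F --> b -> (fun t => f t * g t) @ F --> a * b.
Proof.
move=> fa gb.
exact: (cvg_comp2 fa gb (@mulg_continuous G (a, b))).
Qed.

Lemma cvgVg (G : topologicalGroupType) (T : Type) (F : set_system T)
    (FF : Filter F) (f : T -> G) (a : G) :
  f @ F --> a -> (fun t => (f t)^-1) @ F --> a^-1.
Proof. by move=> fa; exact: cvg_comp fa (@invg_continuous G a). Qed.

Lemma mulg_continuousl (G : topologicalGroupType) (a : G) :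
  continuous (fun x : G => a * x).
Proof. by move=> x; apply: cvgMg; [exact: cvg_cst|exact: cvg_id]. Qed.

Lemma mulg_continuousr (G : topologicalGroupType) (a : G) :
  continuous (fun x : G => x * a).
Proof. by move=> x; apply: cvgMg; [exact: cvg_id|exact: cvg_cst]. Qed.

Lemma topgroup_hom1 (G H : topologicalGroupType) (f : G -> H) :
  topgroup_hom f -> f 1 = 1.
Proof. by move=> [_ fM]; apply: (mulgI (f 1)); rewrite -fM !mulg1. Qed.

Lemma topgroup_homV (G H : topologicalGroupType) (f : G -> H) :
  topgroup_hom f -> {morph f : x / x^-1}.
Proof.
move=> fh x; apply: (mulgI (f x)).
by rewrite -fh.2 !mulgV topgroup_hom1.
Qed.

Section Quotient.
Local Open Scope quotient_scope.
Variables (G : topologicalGroupType) (K : set G).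
Hypotheses (nK : normal_subgroup K) (clK : closed K).

Definition coset_rel (x y : G) : bool := `[< K (x^-1 * y) >].

Lemma coset_rel_equiv : equiv_class_of coset_rel.
Proof.
split=> [x|x y|y x z].
- by apply/asboolP; rewrite mulVg; exact: subgroup1.
- apply: asbool_equiv_eq; split=> /(subgroupV nK); by rewrite invgM invgK.
- move=> /asboolP xy /asboolP yz; apply/asboolP.
  by have := subgroupM nK xy yz; rewrite mulgA mulgK.
Qed.

Canonical coset_equiv := EquivRelPack coset_rel_equiv.

Definition coset_space := quotient_topology {eq_quot coset_equiv}.
HB.instance Definition _ := Topological.on coset_space.
HB.instance Definition _ := Quotient.on coset_space.

Local Notation pi := (\pi_coset_space : G -> coset_space).

Lemma pi_eq (x y : G) : (pi x = pi y) <-> K (x^-1 * y).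
Proof.
have E : (x = y %[mod {eq_quot coset_equiv}]) <-> K (x^-1 * y).
  by split=> [/eqmodP/asboolP|Kxy]; last exact/eqmodP/asboolP.
exact: E.
Qed.

Lemma pi_surj (u : coset_space) : exists x, pi x = u.
Proof. by exists (repr u); rewrite reprK. Qed.

Definition coset_mul (u v : coset_space) : coset_space := pi (repr u * repr v).
Definition coset_inv (u : coset_space) : coset_space := pi (repr u)^-1.

Lemma K_repr x : K (x^-1 * repr (pi x)).
Proof. by apply/pi_eq; rewrite reprK. Qed.

Lemma coset_mulE x y : coset_mul (pi x) (pi y) = pi (x * y).
Proof.
apply/esym/pi_eq; rewrite invgM.
have := subgroupM nK (subgroupJ nK y (K_repr x)) (K_repr y).
by rewrite !mulgA mulgK.
Qed.

Lemma coset_invE x : coset_inv (pi x) = pi x^-1.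
Proof.
apply/esym/pi_eq; rewrite invgK.
have := subgroupJ nK x^-1 (subgroupV nK (K_repr x)).
by rewrite invgM !invgK !mulgA mulgK.
Qed.

Lemma coset_mulA : associative coset_mul.
Proof.
move=> u v w; have [[[x <-] [y <-]] [z <-]] := (pi_surj u, pi_surj v, pi_surj w).
by rewrite !coset_mulE mulgA.
Qed.

Lemma coset_mul1g : left_id (pi 1) coset_mul.
Proof. by move=> u; have [x <-] := pi_surj u; rewrite coset_mulE mul1g. Qed.

Lemma coset_mulVg : left_inverse (pi 1) coset_inv coset_mul.
Proof.
by move=> u; have [x <-] := pi_surj u; rewrite coset_invE coset_mulE mulVg.
Qed.

Lemma coset_mulg1 : right_id (pi 1) coset_mul.
Proof. by move=> u; have [x <-] := pi_surj u; rewrite coset_mulE mulg1. Qed.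

Lemma coset_mulgV : right_inverse (pi 1) coset_inv coset_mul.
Proof.
by move=> u; have [x <-] := pi_surj u; rewrite coset_invE coset_mulE mulgV.
Qed.

HB.instance Definition _ := isGroup.Build coset_space
  coset_mulA coset_mul1g coset_mulg1 coset_mulVg coset_mulgV.

Lemma pi_mul : {morph pi : x y / x * y}.
Proof. by move=> x y; rewrite -coset_mulE. Qed.

Lemma pi_inv : {morph pi : x / x^-1}.
Proof. by move=> x; rewrite -coset_invE. Qed.

Lemma pi_cts : continuous pi.
Proof. exact: pi_continuous. Qed.

(** The saturation of an open set is a union of its translates.  Openness of the
    projection is what makes multiplication continuous on the quotient. *)
Lemma pi_open (U : set G) : open U -> open (pi @` U).
Proof.
move=> oU; rewrite /open /= /quotient_open.
have -> : pi @^-1` (pi @` U) = \bigcup_(k in K) ((fun x => x * k) @^-1` U).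
  apply/seteqP; split=> [x [y Uy /pi_eq Kxy]|x [k Kk Uxk]].
    exists (x^-1 * y); last by rewrite /= mulVKg.
    by have := subgroupV nK Kxy; rewrite invgM invgK.
  by exists (x * k) => //; apply/esym/pi_eq; rewrite mulKg.
apply: bigcup_open => k _; apply: open_comp oU => x _.
exact: mulg_continuousr.
Qed.

Lemma pi_nbhs (x : G) (U : set G) : nbhs x U -> nbhs (pi x) (pi @` U).
Proof.
rewrite !nbhsE => -[V [oV Vx] VU]; exists (pi @` V); last exact: image_subset.
by split; [exact: pi_open|exists x].
Qed.

Lemma coset_mul_continuous :
  continuous (fun uv : coset_space * coset_space => uv.1 * uv.2).
Proof.
move=> [u v]; have [[x <-] [y <-]] := (pi_surj u, pi_surj v).
move=> A; rewrite /= -pi_mul => /pi_cts Axy.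
have [[V W] /= [xV yW] VW] := @mulg_continuous G (x, y) _ Axy.
exists (pi @` V, pi @` W) => /=; first by split; exact: pi_nbhs.
move=> [_ _] [/= [a Va <-] [b Wb <-]]; rewrite -pi_mul.
exact: (VW (a, b)).
Qed.

Lemma coset_inv_continuous : continuous (fun u : coset_space => u^-1).
Proof.
move=> u; have [x <-] := pi_surj u.
move=> A; rewrite /= -pi_inv => /pi_cts Ax.
have := pi_nbhs (@invg_continuous G x _ Ax).
by apply: filterS => _ [a Aa <-]; move: Aa; rewrite /= pi_inv.
Qed.

HB.instance Definition _ := Topological_isTopologicalGroup.Build coset_space
  coset_mul_continuous coset_inv_continuous.

(** Cosets of [x] and [y] are distinct iff [x^-1 * y] avoids the closed set [K],
    which persists for nearby pairs. *)
Lemma coset_hausdorff : hausdorff_space coset_space.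
Proof.
move=> u v; have [[x <-] [y <-]] := (pi_surj u, pi_surj v) => uv.
apply: contrapT => npi.
have : \forall p \near (x, y), (~` K) (p.1^-1 * p.2).
  have ct : (fun p : G * G => p.1^-1 * p.2) @ (x, y) --> x^-1 * y.
    by apply: cvgMg; [apply: cvgVg; exact: cvg_fst|exact: cvg_snd].
  apply: ct; apply: open_nbhs_nbhs; split; first exact: closed_openC.
  by move=> /pi_eq.
move=> [[V W] /= [xV yW] VW].
have [_ [[a Va <-] [b Wb /esym ab]]] := uv _ _ (pi_nbhs xV) (pi_nbhs yW).
by apply: (VW (a, b)); [split|exact/pi_eq].
Qed.

(** The quotient enters the sequel only through these properties. *)
Lemma quotient_exists :
  exists (Q : topologicalGroupType) (q : G -> Q),
    [/\ topgroup_hom q, hausdorff_space Q, range q = setT & kernel q = K].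
Proof.
exists coset_space, pi; split=> //.
- by split; [exact: pi_cts|exact: pi_mul].
- exact: coset_hausdorff.
- by apply/seteqP; split=> // u _; have [x <-] := pi_surj u; exists x.
- apply/seteqP; split=> x; rewrite /kernel /=.
    move=> /esym /pi_eq; by rewrite invg1 mul1g.
  by move=> Kx; apply/esym/pi_eq; rewrite invg1 mul1g.
Qed.

End Quotient.

(** * Open normal subgroups of a compact zero-dimensional group *)
Lemma normal_subgroup_bigcap (G : topologicalGroupType) (I : Type) (D : set I)
    (N : I -> set G) :
  (forall i, D i -> normal_subgroup (N i)) ->
  normal_subgroup (\bigcap_(i in D) N i).
Proof.
move=> nN; split=> [|x y Nx Ny|x Nx|x y Nx] i Di; have nNi := nN i Di.
- exact: subgroup1.
- by apply: subgroupM => //; [exact: Nx|exact: Ny].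
- by apply: subgroupV => //; exact: Nx.
- by apply: subgroupJ => //; exact: Nx.
Qed.

Lemma subgroup_open (G : topologicalGroupType) (N : set G) :
  normal_subgroup N -> nbhs 1 N -> open N.
Proof.
move=> nN N1; rewrite openE => x Nx; rewrite /interior.
have : nbhs x ((fun y => x^-1 * y) @^-1` N).
  by apply: mulg_continuousl; rewrite mulVg.
by apply: filterS => y /= /(subgroupM nN Nx); rewrite mulVKg.
Qed.

(** The coset of a point of the closure is an open set, hence meets the subgroup. *)
Lemma open_subgroup_closed (G : topologicalGroupType) (N : set G) :
  normal_subgroup N -> open N -> closed N.
Proof.
move=> nN oN y Ny; have : nbhs y ((fun z => y^-1 * z) @^-1` N).
  apply: mulg_continuousl; rewrite mulVg.
  by apply: open_nbhs_nbhs; split=> //; exact: subgroup1.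
move=> /Ny[z [Nz /(subgroupV nN) /(subgroupM nN Nz)]].
by rewrite invgM invgK mulVKg.
Qed.

(** The witness is the group of those [x] whose insertion anywhere in a product
    does not affect membership in [U].  It is a normal subgroup by pure algebra
    and lies in [U] because 1 does.  For fixed [g] and [h] the condition is open
    in [(g, h, x)], as [U] is clopen, and holds at [x = 1]; the tube lemma over
    the compact space of pairs [(g, h)] makes it hold for all [x] near 1. *)
Lemma open_normal_subgroup_sub (G : topologicalGroupType) (U : set G) :
  compact [set: G] -> clopen U -> U 1 ->
  exists N, [/\ normal_subgroup N, open N & N `<=` U].
Proof.
move=> cG [oU cU] U1.
pose N := [set x : G | forall g h, U (g * x * h) <-> U (g * h)].
have nN : normal_subgroup N.
  split=> [g h|x y Nx Ny g h|x Nx g h|x y Nx g h].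
  - by rewrite mulg1.
  - by rewrite !mulgA (Ny (g * x) h) Nx.
  - by rewrite -(Nx (g * x^-1) h) mulgVK.
  - by have := Nx (g * y^-1) (y * h); rewrite !mulgA mulgVK.
exists N; split=> //; last first.
  by move=> x /(_ 1 1); rewrite !mul1g !mulg1 => Ux; apply/Ux.
apply: (subgroup_open nN).
have near_iff (T : topologicalType) (f g : T -> G) (t : T) : f t = g t ->
    {for t, continuous f} -> {for t, continuous g} ->
    \forall s \near t, U (f s) <-> U (g s).
  move=> fg cf cg; have [Ut|nUt] := pselect (U (f t)).
    have Vf : nbhs t (f @^-1` U) by apply: cf; exact: open_nbhs_nbhs.
    have Vg : nbhs t (g @^-1` U) by apply: cg; apply: open_nbhs_nbhs; rewrite -fg.
    by apply: filterS2 Vf Vg => s.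
  have Vf : nbhs t (f @^-1` ~` U).
    by apply: cf; apply: open_nbhs_nbhs; split=> //; exact: closed_openC.
  have Vg : nbhs t (g @^-1` ~` U).
    by apply: cg; apply: open_nbhs_nbhs; rewrite -fg; split=> //; exact: closed_openC.
  by apply: filterS2 Vf Vg => s /= ? ?; split.
have cGG : compact [set: G * G] by rewrite -setXTT; exact: compact_setX.
pose P (x : G) (gh : G * G) := U (gh.1 * x * gh.2) <-> U (gh.1 * gh.2).
suff : \forall x \near (1 : G), [set: G * G] `<=` P x.
  by apply: filterS => x Px g h; exact: (Px (g, h)).
(* the tube lemma: it suffices to treat each (g, h) locally *)
apply: ((compact_near_coveringP _).1 cGG) => -[g h] _.
have c1 : continuous (fun t : (G * G) * G => t.1.1 * t.2 * t.1.2).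
  move=> t; apply: cvgMg.
    apply: cvgMg; last exact: cvg_snd.
    by apply: (@cvg_comp _ _ _ fst fst); exact: cvg_fst.
  by apply: (@cvg_comp _ _ _ fst snd); [exact: cvg_fst|exact: cvg_snd].
have c2 : continuous (fun t : (G * G) * G => t.1.1 * t.1.2).
  move=> t; apply: cvgMg.
    by apply: (@cvg_comp _ _ _ fst fst); exact: cvg_fst.
  by apply: (@cvg_comp _ _ _ fst snd); [exact: cvg_fst|exact: cvg_snd].
have := @near_iff ((G * G) * G)%type _ _ ((g, h), 1) _ (c1 _) (c2 _).
by apply; rewrite /= mulg1.
Qed.

Lemma open_normal_subgroup_nbhs (G : topologicalGroupType) (U : set G) :
  compact [set: G] -> clopen_basis G -> nbhs 1 U ->
  exists N, [/\ normal_subgroup N, open N & N `<=` U].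
Proof.
move=> cG [_ clB] /clB[V [clV V1] VU].
have [N [nN oN NV]] := open_normal_subgroup_sub cG clV V1.
by exists N; split=> //; exact: subset_trans NV VU.
Qed.

(** * Compactness *)

(** Linearly ordered families form a filter base, so the finite intersection
    property is automatic; a cluster point lies in every closed member. *)
Lemma compact_chain_bigcap (T : topologicalType) (I : Type) (D : set I)
    (C : I -> set T) :
  compact [set: T] -> D !=set0 ->
  (forall i, D i -> closed (C i)) -> (forall i, D i -> C i !=set0) ->
  (forall i j, D i -> D j -> C i `<=` C j \/ C j `<=` C i) ->
  \bigcap_(i in D) C i !=set0.
Proof.
move=> cT D0 clC C0 chainC.
have PF : ProperFilter (filter_from D C).
  apply: filter_from_proper => //; apply: filter_from_filter => // i j Di Dj.
  have [Cij|Cji] := chainC i j Di Dj.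
    by exists i => // x Cx; split=> //; exact: Cij.
  by exists j => // x Cx; split=> //; exact: Cji.
have [|x [_ xF]] := cT _ PF; first by have [i Di] := D0; exists i.
by exists x => i Di; apply: clC => // V; apply: xF; exists i.
Qed.

(** Finitely many of the open cosets of [N] cover G.  Compactness
    is used along the filter generated by the sets [B | A `<=` B] with [A]
    finite: near each point, all large enough sets of representatives cover. *)
Lemma open_subgroup_finite_index (G : topologicalGroupType) (N : set G) :
  compact [set: G] -> normal_subgroup N -> open N ->
  exists2 C : set G, finite_set C & forall x, exists2 c, C c & N (c^-1 * x).
Proof.
move=> cG nN oN.
pose F := filter_from finite_set (fun A : set G => [set B | A `<=` B]).
have FF : Filter F.
  apply: filter_from_filter; first by exists set0.
  move=> A B fA fB; exists (A `|` B); first by rewrite finite_setU.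
  by move=> S ABS; split=> x ?; apply: ABS; [left|right].
suff : \forall B \near F, [set: G] `<=` (fun x => exists2 c, B c & N (c^-1 * x)).
  by move=> [C fC CN]; exists C => // x; exact: (CN C).
apply: ((compact_near_coveringP _).1 cG) => x _.
exists ((fun y => x^-1 * y) @^-1` N, [set B | [set x] `<=` B]) => /=.
  split; last by exists [set x].
  apply: mulg_continuousl; rewrite mulVg.
  by apply: open_nbhs_nbhs; split=> //; exact: subgroup1.
by move=> [y B] /= [Ny xB]; exists x => //; exact: xB.
Qed.

Lemma closed_preimage1 (T U : topologicalType) (f : T -> U) (u : U) :
  continuous f -> hausdorff_space U -> closed [set x | f x = u].
Proof.
move=> cf hU; apply: (preimage_closed (f := f) (D := [set u])) => //.
exact/accessible_closed_set1/hausdorff_accessible.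
Qed.

Lemma compact_image_closed (T U : topologicalType) (f : T -> U) (C : set T) :
  compact [set: T] -> hausdorff_space U -> continuous f -> closed C ->
  closed (f @` C).
Proof.
move=> cT hU cf clC; apply: compact_closed => //; apply: continuous_compact.
  exact: continuous_subspaceT.
exact: subclosed_compact clC cT _.
Qed.

(** The map induced by [f] on the image [B] of [g].  It is continuous because [g],
    as a closed surjection from a compact space, is a quotient map. *)
Section Descend.
Variables (G A B : topologicalGroupType) (f : G -> A) (g : G -> B).

Definition descend (y : B) : A := f (xget 1 [set x | g x = y]).

Hypotheses (fhom : topgroup_hom f) (ghom : topgroup_hom g).
Hypotheses (gsurj : range g = setT) (kgf : kernel g `<=` kernel f).

Lemma descendE (x : G) : descend (g x) = f x.
Proof.
rewrite /descend; case: xgetP => [t _ /= gt|/(_ x)]; last by case.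
have : kernel f (x^-1 * t).
  by apply: kgf; rewrite /kernel /= ghom.2 gt -ghom.2 mulVg topgroup_hom1.
by rewrite /kernel /= fhom.2 (topgroup_homV fhom) => /mulg1_eq; rewrite invgK.
Qed.

Lemma descend_hom :
  compact [set: G] -> hausdorff_space B -> topgroup_hom descend.
Proof.
move=> cG hB; have gS y : exists x, g x = y.
  by have : range g y by [rewrite gsurj]; case=> x _; exists x.
split; last first.
  move=> y z; have [[x <-] [t <-]] := (gS y, gS z).
  by rewrite -ghom.2 !descendE fhom.2.
apply/continuous_closedP => C clC.
have -> : descend @^-1` C = g @` (f @^-1` C).
  apply/seteqP; split=> [y|_ [x Cx <-]]; rewrite /= ?descendE //.
  by have [x <-] := gS y; rewrite descendE; exists x.
apply: compact_image_closed => //; first exact: ghom.1.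
by have /continuous_closedP := fhom.1; exact.
Qed.

Lemma descend_range : range f = setT -> range descend = setT.
Proof.
move=> fT; apply/seteqP; split=> // a _.
have : range f a by rewrite fT.
by move=> [x _ <-]; exists (g x); rewrite ?descendE.
Qed.

End Descend.

(** * The sequence of quotients *)

Section UptoTheory.
Variable kappa : ordinalNumber.
Implicit Types a b c : upto kappa.

Lemma upto_le_refl a : upto_le a a. Proof. by case: a => /=. Qed.

Lemma upto_le_trans a b c : upto_le a b -> upto_le b c -> upto_le a c.
Proof. by case: a b c => [x|] [y|] [z|] //=; exact: le_trans. Qed.

Lemma upto_leNgt a b : ~~ upto_le a b = upto_lt b a.
Proof.
rewrite /upto_lt; case: a b => [x|] [y|] //=.
by rewrite -ltNge; case: ltgtP.
Qed.

Lemma upto_le_total a b : upto_le a b \/ upto_le b a.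
Proof. by case: a b => [x|] [y|] //=; auto; apply/orP/le_total. Qed.

Lemma upto_ltW a b : upto_lt a b -> upto_le a b. Proof. by case/andP. Qed.

Lemma upto_lt_le_trans a b c : upto_lt a b -> upto_le b c -> upto_lt a c.
Proof.
rewrite -!upto_leNgt => nba bc; apply: contra nba; exact: upto_le_trans.
Qed.

End UptoTheory.

Section Sequence.
Variables (G : topologicalGroupType) (kappa : ordinalNumber) (N : kappa -> set G).
Hypotheses (cG : compact_group G).
Hypotheses (nN : forall b, normal_subgroup (N b)) (oN : forall b, open (N b)).
Hypothesis N1 : \bigcap_b N b = [set 1].

Definition level (a : upto kappa) : set G :=
  \bigcap_(b in [set b | upto_lt (Some b) a]) N b.

Lemma level_normal a : normal_subgroup (level a).
Proof. exact: normal_subgroup_bigcap. Qed.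

Lemma level_closed a : closed (level a).
Proof. by apply: closed_bigI => b _; exact: open_subgroup_closed. Qed.

Lemma level_antitone a b : upto_le a b -> level b `<=` level a.
Proof. by move=> ab x bx c ca; apply: bx; exact: upto_lt_le_trans ab. Qed.

Lemma level_None : level None = [set 1].
Proof.
by rewrite -N1; apply/seteqP; split=> x xN b Nb; apply: xN.
Qed.

Lemma level_succ (a : kappa) b : is_succ (Some a) b ->
  level b = level (Some a) `&` N a.
Proof.
move=> [ab bleast]; apply/seteqP; split=> [x bx|x [ax Nx] c cb].
  by split; [exact: level_antitone (upto_ltW ab) _ bx|exact: bx].
have [ca|] := boolP (upto_le (Some a) (Some c)); last first.
  by rewrite upto_leNgt => ca; exact: ax.
have [ac|] := boolP (upto_lt (Some a) (Some c)).
  by move: cb => /=; rewrite -upto_leNgt bleast.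
rewrite -upto_leNgt negbK /= => le_ca.
by have -> : c = a by apply/eqP; rewrite eq_le le_ca.
Qed.

(** At a limit, every [b < d] has some [c] with [b < c < d], so that [N b] is
    already taken into account at level [c]. *)
Lemma level_limit d x : is_limit d ->
  (forall a, upto_lt a d -> level a x) -> level d x.
Proof.
move=> [_ nsucc] xd b bd.
have [c bc cd] : exists2 c, upto_lt (Some b) c & upto_lt c d.
  apply: contrapT => nc; apply: (nsucc (Some b)); split=> // c bc.
  by apply: contrapT => /negP; rewrite upto_leNgt => cd; apply: nc; exists c.
exact: xd cd _ bc.
Qed.

(** The stages below kappa are any Hausdorff groups realizing the quotients by
    the levels; the last one is G itself, projected to by the identity, in
    agreement with [level None] being trivial. *)
Variables (Q : kappa -> topologicalGroupType) (q : forall a, G -> Q a).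
Hypothesis q_hom : forall a, topgroup_hom (@q a).
Hypothesis Q_hausdorff : forall a, hausdorff_space (Q a).
Hypothesis q_range : forall a, range (@q a) = setT.
Hypothesis q_kernel : forall a, kernel (@q a) = level (Some a).

Local Notation group := (stage G Q).

Definition proj (a : upto kappa) : G -> group a :=
  match a with Some x => @q x | None => id end.

Lemma proj_hom a : topgroup_hom (@proj a).
Proof. by case: a => [a|]; [exact: q_hom|split=> // x; exact: cvg_id]. Qed.

Lemma proj_range a : range (@proj a) = setT.
Proof.
by case: a => [a|]; [exact: q_range|apply/seteqP; split=> // x _; exists x].
Qed.

Lemma proj_surj a (y : group a) : exists x, proj a x = y.
Proof.
by have : range (@proj a) y by [rewrite proj_range]; case=> x _; exists x.
Qed.

Lemma group_hausdorff a : hausdorff_space (group a).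
Proof. by case: a => [a|]; [exact: Q_hausdorff|exact: cG.2]. Qed.

Lemma proj_kernel a : kernel (@proj a) = level a.
Proof. by case: a => [a|]; [exact: q_kernel|rewrite level_None]. Qed.

Lemma group_compact a : compact_group (group a).
Proof.
split; last exact: group_hausdorff.
rewrite -proj_range; apply: continuous_compact cG.1.
exact/continuous_subspaceT/(proj_hom a).1.
Qed.

Lemma proj_eq a x y : proj a x = proj a y <-> level a (x^-1 * y).
Proof.
rewrite -proj_kernel /kernel /= (proj_hom a).2 (topgroup_homV (proj_hom a)).
by split=> [->|/mulg1_eq]; rewrite ?mulVg // invgK.
Qed.

Definition quotient_bond (a b : upto kappa) : group b -> group a :=
  descend (proj a) (proj b).

Lemma proj_sub a b : upto_le a b -> kernel (proj b) `<=` kernel (proj a).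
Proof. by rewrite !proj_kernel; exact: level_antitone. Qed.

Lemma quotient_bondE a b x : upto_le a b -> quotient_bond a (proj b x) = proj a x.
Proof.
move=> ab; apply: descendE; [exact: proj_hom|exact: proj_hom|exact: proj_sub].
Qed.

Lemma quotient_bond_hom a b : upto_le a b -> topgroup_hom (@quotient_bond a b).
Proof.
move=> ab; apply: descend_hom; [exact: proj_hom|exact: proj_hom| |exact: proj_sub| |].
- exact: proj_range.
- exact: cG.1.
- exact: group_hausdorff.
Qed.

Lemma quotient_bond_id a : @quotient_bond a a =1 id.
Proof.
by move=> y; have [x <-] := proj_surj y; rewrite quotient_bondE ?upto_le_refl.
Qed.

Lemma quotient_bond_comp a b c : upto_le a b -> upto_le b c ->
  @quotient_bond a b \o @quotient_bond b c =1 @quotient_bond a c.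
Proof.
move=> ab bc y; have [x <-] := proj_surj y.
by rewrite /= !quotient_bondE // (upto_le_trans ab).
Qed.

(** A compatible family of points [f a h] is lifted to G by intersecting the chain
    of its fibres, which are nonempty and closed.  For continuity at [h], the
    points outside a neighbourhood [V] of the image whose projection to stage [a]
    is [f a h] form a chain of closed sets with empty intersection; one of them is
    therefore empty, and stage [a] alone detects leaving [V]. *)
Lemma quotient_bond_limit d : is_limit d ->
  is_inverse_limit (kappa := kappa) (G_ := group) quotient_bond d.
Proof.
move=> dlim H f f_hom f_comp.
have ltd_ex : [set a | upto_lt a d] !=set0.
  apply: contrapT => nd; apply: dlim.1 => b; apply: contrapT => /negP.
  by rewrite upto_leNgt => bd; apply: nd; exists b.
(* the earlier bonds separate the points of stage d *)
have sep (y z : group d) :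
    (forall a, upto_lt a d -> quotient_bond a y = quotient_bond a z) -> y = z.
  have [[x <-] [t <-]] := (proj_surj y, proj_surj z) => yz.
  apply/proj_eq/(level_limit dlim) => a ad; apply/proj_eq.
  by have := yz a ad; rewrite !quotient_bondE // upto_ltW.
have lift h : exists x, forall a, upto_lt a d -> proj a x = f a h.
  pose C a := [set x | proj a x = f a h].
  have C_anti a b : upto_le a b -> upto_lt b d -> C b `<=` C a.
    move=> ab bd x Cx; rewrite /C /=.
    by rewrite -(quotient_bondE x ab) Cx -(f_comp a b ab bd).
  have [a ad|a ad|a b ad bd|x xC] := compact_chain_bigcap (C := C) cG.1 ltd_ex.
  - by apply: closed_preimage1; [exact: (proj_hom a).1|exact: group_hausdorff].
  - exact: proj_surj.
  - by have [/C_anti|/C_anti] := upto_le_total a b; [right|left]; auto.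
  - by exists x.
have [l lP] := choice lift.
pose g h := proj d (l h).
have gP h a : upto_lt a d -> quotient_bond a (g h) = f a h.
  by move=> ad; rewrite quotient_bondE ?lP // upto_ltW.
have bond_cts a : upto_lt a d -> topgroup_hom (@quotient_bond a d).
  by move=> /upto_ltW; exact: quotient_bond_hom.
exists g; split; last first.
  move=> g' [_ g'P]; apply: funext => h; apply: sep => a ad.
  by rewrite gP // -(g'P a ad).
split; last by move=> a ad h; exact: gP.
split; last first.
  move=> h k; apply: sep => a ad.
  by rewrite (bond_cts a ad).2 !gP // (f_hom a ad).2.
move=> h U; rewrite nbhsE => -[V [oV Vgh] VU].
apply: filterS VU _.
(* what is outside V but not distinguished from g h at stage a *)
pose D a := ~` V `&` [set y : group d | quotient_bond a y = f a h].
have [a ad Da0] : exists2 a, upto_lt a d & D a = set0.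
  apply: contrapT => nD.
  have [a ad|a ad|a b ad bd|y yD] := compact_chain_bigcap (C := D) (group_compact d).1 ltd_ex.
  - apply: closedI; first exact: open_closedC.
    by apply: closed_preimage1; [exact: (bond_cts a ad).1|exact: group_hausdorff].
  - by apply/set0P/eqP => Da; apply: nD; exists a.
  - have D_anti c e : upto_le c e -> upto_lt e d -> D e `<=` D c.
      move=> ce ed y [nVy yf]; split=> //=.
      have /= <- := quotient_bond_comp ce (upto_ltW ed) y.
      by rewrite yf; exact: f_comp.
    by have [/D_anti|/D_anti] := upto_le_total a b; [right|left]; auto.
  - have [b bd] := ltd_ex; apply: (yD b bd).1.
    by have <- : g h = y by apply: sep => c cd; rewrite gP // (yD c cd).2.
have : nbhs (f a h) (~` (@quotient_bond a d @` (~` V))).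
  apply: open_nbhs_nbhs; split.
    apply: closed_openC; apply: compact_image_closed.
    - exact: (group_compact d).1.
    - exact: group_hausdorff.
    - exact: (bond_cts a ad).1.
    - exact: open_closedC.
  by move=> [y nVy yf]; have : D a y by []; rewrite Da0.
move=> nfah; have near_h : \forall k \near h, (~` (@quotient_bond a d @` (~` V))) (f a k).
  exact: (f_hom a ad).1 nfah.
apply: filterS near_h => k nk.
by apply: contrapT => nV; apply: nk; exists (g k); rewrite ?gP.
Qed.

Definition quotient_sequence : continuousInverseSequence kappa G :=
  @Build_continuousInverseSequence kappa G Q quotient_bond group_compact quotient_bond_hom
    quotient_bond_id quotient_bond_comp quotient_bond_limit.

(** The kernel consists of the classes of points of [level a]; two of them with the
    same coset of [N a] have the same class modulo [level b], which is
    [level a `&` N a].  So there are at most as many as cosets of [N a]. *)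
Lemma quotient_bond_succ (a : kappa) b : is_succ (Some a) b ->
  epimorphism (@quotient_bond (Some a) b) /\
  finite_set (kernel (@quotient_bond (Some a) b)).
Proof.
move=> ab; have le_ab := upto_ltW ab.1; split; first split.
- exact: quotient_bond_hom.
- apply: descend_range; [exact: proj_hom|exact: proj_hom|exact: proj_sub|].
  exact: proj_range.
have [C finC CN] := open_subgroup_finite_index cG.1 (nN a) (oN a).
(* a point of [level a] in the coset c N a, if there is one *)
pose r c := xget 1 [set k | level (Some a) k /\ N a (c^-1 * k)].
apply: (sub_finite_set _ (finite_image (fun c => proj b (r c)) finC)) => y.
have [x <-] := proj_surj y => x1.
have ax : level (Some a) x.
  by rewrite -proj_kernel /kernel /mkset -(quotient_bondE x le_ab).
have [c Cc cx] := CN x; exists c => //.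
have [ar cr] : level (Some a) (r c) /\ N a (c^-1 * r c).
  by rewrite /r; case: xgetP => [k -> //|/(_ x)]; case.
apply/proj_eq; rewrite (level_succ ab); split.
  by apply: (subgroupM (level_normal _)) => //; apply: (subgroupV (level_normal _)).
have := subgroupM (nN a) (subgroupV (nN a) cr) cx.
by rewrite invgM invgK !mulgA mulgK.
Qed.

Lemma quotient_group_zero a : is_zero a -> [set: group a] = [set 1].
Proof.
move=> a0; apply/seteqP; split=> // y _; have [x <-] := proj_surj y.
have : kernel (proj a) x; last by [].
by rewrite proj_kernel => b /=; rewrite -upto_leNgt a0.
Qed.

End Sequence.

Theorem proposition2p8 (G : topologicalGroupType) :
  compact_group G -> clopen_basis G ->
  exists (kappa : ordinalNumber) (S : continuousInverseSequence kappa G),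
    [/\ forall a : upto kappa, is_zero a -> [set: obj S a] = [set 1],
        forall (a : kappa) (b : upto kappa), is_succ (Some a) b ->
          epimorphism (bond S (Some a) b) /\
          finite_set (kernel (bond S (Some a) b))
      & infinite_set [set: G] -> is_weight G kappa].
Proof.
move=> cG clB.
have [|kappa [kappa_init [B basisB kappaB] kappa_le]] :=
  @least_cardinal (set G) (@basis G); first by exists [set U | clopen U].
have [e eB] : exists e : kappa -> set G, set_surj [set: kappa] B e.
  by apply/pcard_surjP; move: kappaB; rewrite card_eq_le => /andP[].
(* The list e may leave B, and the members of B that miss 1 impose nothing:
   there the whole group serves as N b. *)
have /choice[N NP] (b : kappa) : exists N, [/\ normal_subgroup N, open N &
    B (e b) -> e b 1 -> N `<=` e b].
  have [[Bb b1]|nb] := pselect (B (e b) /\ e b 1).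
    have [|N [nN oN Nb]] := @open_normal_subgroup_nbhs G (e b) cG.1 clB.
      by apply: open_nbhs_nbhs; split=> //; exact: basisB.1.
    by exists N.
  exists setT; split=> // [|Bb b1]; first exact: openT.
  by case: nb.
have nN b : normal_subgroup (N b) by have [] := NP b.
have oN b : open (N b) by have [] := NP b.
have N1 : \bigcap_b N b = [set 1].
  apply/seteqP; split=> [x Nx|_ -> b _]; last exact: subgroup1.
  apply: cG.2 => V W Vx W1; exists x; split; first exact: nbhs_singleton.
  have [U [BU U1] UW] := basisB.2 1 W W1.
  have [b _ bU] := eB U BU; apply: UW.
  by rewrite -bU; have [_ _] := NP b; rewrite bU; apply=> //; exact: Nx.
have /choice[Q /(_ _)/cid-/all_tag[q qP]] (a : kappa) : exists Q : topologicalGroupType,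
    exists q : G -> Q, [/\ topgroup_hom q, hausdorff_space Q, range q = setT
      & kernel q = level N (Some a)].
  by apply: quotient_exists; [exact: level_normal|exact: level_closed].
have q_hom a : topgroup_hom (q a) by have [] := qP a.
have Q_hausdorff a : hausdorff_space (Q a) by have [] := qP a.
have q_range a : range (q a) = setT by have [] := qP a.
have q_kernel a : kernel (q a) = level N (Some a) by have [] := qP a.
exists kappa, (quotient_sequence cG N1 q_hom Q_hausdorff q_range q_kernel).
split=> [a a0|a b ab|_].
- exact: (quotient_group_zero N1 q_range q_kernel a0).
- exact: (quotient_bond_succ cG nN oN N1 q_hom Q_hausdorff q_range q_kernel ab).
- by split=> //; exists B.
Qed.
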